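(* Let $(X,d)$ be a metric space, $\lambda\in\mathbb R$, and let $\phi:X\to(-\infty,+\infty]$ be approximately $\lambda$-convex with complete sublevels. Then $\phi$ is quadratically bounded from below. More precisely, for every $o\in\mathrm{Dom}(\phi)$ and every $\kappa_o>-\lambda$ it satisfies $$\phi(x)+\frac{\kappa_o}2d^2(x,o)\ge\phi_o\quad\text{for every }x\in X,$$ with $$\phi_o:=\phi(o)-\frac{\big(\phi(o)-m_o+\frac{\lambda^+}2\big)^2}{2(\lambda+\kappa_o)}-\frac{\lambda+\kappa_o}2,\qquad m_o:=\inf\{\phi(x):x\in X,\ d(x,o)\le1\}>-\infty.$$ Furthermore, the functional $x\mapsto\phi(x)-\frac\lambda2d^2(x,o)$ is linearly bounded from below and satisfies $$\phi(x)-\frac\lambda2d^2(x,o)+\ell_o\,d(x,o)\ge\phi'_o\quad\text{for every }x\in X,$$ with $$\ell_o:=\phi(o)-m_o+\frac\lambda2,\qquad\phi'_o:=m_o-\frac{\lambda^-}2.$$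
   Context: $\mathrm{Dom}(\phi):=\{x\in X:\phi(x)<+\infty\}$. ''Complete sublevels'' means that $\{x\in X:\phi(x)\le c\}$ is complete for every $c\in\mathbb R$. $\lambda^+=\max(\lambda,0)$, $\lambda^-=\max(-\lambda,0)$. For $\vartheta,\varepsilon\in(0,1)$, a point $x$ is a $(\vartheta,\varepsilon)$-intermediate point between $x_0,x_1\in X$ if $$\frac{d^2(x_0,x)}\vartheta+\frac{d^2(x,x_1)}{1-\vartheta}\le d^2(x_0,x_1)\big(1+\varepsilon^2\vartheta(1-\vartheta)\big).$$ $\phi$ is approximately $\lambda$-convex if for every $x_0,x_1\in\mathrm{Dom}(\phi)$ and every $\vartheta,\varepsilon\in(0,1)$ there exists a $(\vartheta,\varepsilon)$-intermediate point $x_{\vartheta,\varepsilon}\in X$ between $x_0$ and $x_1$ such that $$\phi(x_{\vartheta,\varepsilon})\le(1-\vartheta)\phi(x_0)+\vartheta\phi(x_1)-\frac{\lambda-\varepsilon}2\vartheta(1-\vartheta)d^2(x_0,x_1).$$ $\phi$ is quadratically (resp. linearly) bounded from below if there exist $o\in X$ and real constants $\phi_o,\kappa_o$ (resp. $\phi_o,\ell_o$) such that $\phi(x)+\frac{\kappa_o}2d^2(x,o)\ge\phi_o$ (resp. $\phi(x)+\ell_o d(x,o)\ge\phi_o$) for every $x\in X$. *)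

(* Defs.v *)
From HB Require Import structures.
From mathcomp Require Import all_boot all_order all_algebra.
From mathcomp Require Import all_classical all_reals all_analysis.
Set Implicit Arguments.
Unset Strict Implicit.
Unset Printing Implicit Defensive.
Import Order.TTheory GRing.Theory Num.Theory.

Local Open Scope classical_set_scope.
Local Open Scope ring_scope.

Section Definitions.
Context {R : realType} {X : metricType R}.
Implicit Types (phi : X -> \bar R) (o x : X).

Definition Dom phi : set X := [set x | (phi x < +oo)%E].

Definition complete_subset (A : set X) : Prop :=
  forall u : nat -> X, (forall n, A (u n)) -> cauchy (u @ \oo) ->
    exists2 x, A x & u @ \oo --> x.

Definition complete_sublevels phi : Prop :=
  forall c : R, complete_subset [set x | (phi x <= c%:E)%E].

Definition intermediate_point (theta eps : R) (x0 x1 x : X) : Prop :=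
  mdist x0 x ^+ 2 / theta + mdist x x1 ^+ 2 / (1 - theta)
    <= mdist x0 x1 ^+ 2 * (1 + eps ^+ 2 * theta * (1 - theta)).

Definition approx_convex (lambda : R) phi : Prop :=
  forall x0 x1, Dom phi x0 -> Dom phi x1 ->
  forall theta eps : R, 0 < theta < 1 -> 0 < eps < 1 ->
  exists x, intermediate_point theta eps x0 x1 x /\
    (phi x <= (1 - theta)%:E * phi x0 + theta%:E * phi x1
      - ((lambda - eps) / 2 * theta * (1 - theta) * mdist x0 x1 ^+ 2)%:E)%E.

Definition quadratically_bounded_below phi : Prop :=
  exists (o : X) (phi_o kappa_o : R),
    forall x, (phi_o%:E <= phi x + (kappa_o / 2 * mdist x o ^+ 2)%:E)%E.

Definition linearly_bounded_below phi : Prop :=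
  exists (o : X) (phi_o ell_o : R),
    forall x, (phi_o%:E <= phi x + (ell_o * mdist x o)%:E)%E.

Definition m_inf phi o : \bar R :=
  ereal_inf [set phi x | x in [set x | mdist x o <= 1]].

(* In the three constants below, [fine] returns the actual real value as soon
   as [phi > -oo], [o] is in [Dom phi] and [m_inf phi o > -oo], because
   [m_inf phi o <= phi o]. *)
Definition phi_cst (lambda kappa : R) phi o : R :=
  fine (phi o)
  - (fine (phi o) - fine (m_inf phi o) + Num.max lambda 0 / 2) ^+ 2
    / (2 * (lambda + kappa))
  - (lambda + kappa) / 2.

Definition ell_cst (lambda : R) phi o : R :=
  fine (phi o) - fine (m_inf phi o) + lambda / 2.

Definition phi'_cst (lambda : R) phi o : R :=
  fine (m_inf phi o) - Num.max (- lambda) 0 / 2.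

Definition sub_quadratic (lambda : R) phi o : X -> \bar R :=
  fun x => (phi x - (lambda / 2 * mdist x o ^+ 2)%:E)%E.

End Definitions.

(* Main.v *)
Require Import Defs.
From HB Require Import structures.
From mathcomp Require Import all_boot all_order all_algebra.
From mathcomp Require Import all_classical all_reals all_analysis.
From mathcomp Require Import ring lra.
Import Order.TTheory GRing.Theory Num.Theory.
Import numFieldNormedType.Exports.

Local Open Scope classical_set_scope.
Local Open Scope ring_scope.

(* Complete sublevels are closed, so [phi] is lower semicontinuous; convexity
   between [o] and the points of the unit ball then gives [m_o > -oo]. For
   [D = d(x, o) >= 1], the point at distance about [1] from [o] on the way to
   [x] has value at least [m_o], and convexity, once the approximation error is
   sent to [0], yields
   [D m_o <= (D - 1) phi(o) + phi(x) - lambda/2 (D^2 - D)].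
   Both bounds follow from this inequality when [D >= 1] and from
   [phi(x) >= m_o] when [D <= 1]. *)

(** A point of the closure is the limit of a sequence in [A]; this sequence is Cauchy, so
    completeness gives it a limit in [A], and limits are unique. *)
Lemma complete_subset_closed (R : realType) (X : metricType R) (A : set X) :
  complete_subset A -> closed A.
Proof.
move=> cA x clx.
have /choice[u uP] (n : nat) : exists y, A y /\ mdist x y < n.+1%:R^-1.
  have n0 : 0 < n.+1%:R^-1 :> R by rewrite invr_gt0.
  have [y []] := clx _ (nbhsx_ballx x _ n0).
  by rewrite ballEmdist; exists y.
have ux : u @ \oo --> x.
  apply/metricType_numDomainType.cvgrPdist_lt => e e0; near=> n.
  apply: (lt_trans (uP n).2); near: n.
  exact: (near_infty_natSinv_lt (PosNum e0)).
have cu : cauchy (u @ \oo).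
  by apply: cauchy_exP => e e0; exists x; exact: ux (nbhsx_ballx x _ e0).
have [y Ay uy] := cA u (fun n => (uP n).1) cu.
by rewrite (cvg_unique (@metric_hausdorff _ X) ux uy).
Unshelve. all: by end_near.
Qed.

Lemma complete_sublevels_lsc (R : realType) (X : metricType R)
    (phi : X -> \bar R) (o : X) (c : R) :
  complete_sublevels phi -> (c%:E < phi o)%E ->
  exists2 r : R, 0 < r & forall y, mdist o y < r -> (c%:E < phi y)%E.
Proof.
move=> cphi co.
have : nbhs o (~` [set x | (phi x <= c%:E)%E]).
  apply: open_nbhs_nbhs; split => /=; last by apply/negP; rewrite -ltNge.
  by apply: closed_openC; apply: complete_subset_closed; exact: cphi.
move=> /nbhs_ballP[r /= r0 rP]; exists r => // y oy.
by rewrite ltNge; apply/negP; apply: rP; rewrite ballEmdist.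
Qed.

(* Writing [a], [b] for the distances to the two end points and [D] for the
   distance between them,
   [a^2/t + b^2/(1-t) = (a+b)^2 + ((1-t)a - tb)^2/(t(1-t))],
   so that [a + b >= D] forces [a] to be close to [t D]. *)
Lemma intermediate_point_mdist (R : realType) (X : metricType R)
    (theta eps : R) (x0 x1 x : X) : 0 < theta < 1 -> 0 < eps ->
  intermediate_point theta eps x0 x1 x ->
  mdist x0 x <= theta * mdist x0 x1 * (1 + 2 * eps).
Proof.
move=> /andP[t0 t1] e0; rewrite /intermediate_point.
have := metric_triangle x0 x x1.
move: (mdist_ge0 x0 x) (mdist_ge0 x x1) (mdist_ge0 x0 x1).
move: (mdist x0 x) (mdist x x1) (mdist x0 x1) => a b D a0 b0 D0 Dab abD.
pose p := theta * (1 - theta).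
have p0 : 0 < p by rewrite mulr_gt0// subr_gt0.
have p1 : p <= 1 by rewrite /p; nra.
have t1n : 1 - theta != 0 by rewrite subr_eq0 gt_eqF.
have tn : theta != 0 by rewrite gt_eqF.
pose v := (1 - theta) * a - theta * b.
have abE : p * (a ^+ 2 / theta + b ^+ 2 / (1 - theta))
    = p * (a + b) ^+ 2 + v ^+ 2.
  by rewrite /p /v; field; rewrite tn t1n.
have {}abD : p * (a + b) ^+ 2 + v ^+ 2 <= p * (D ^+ 2 * (1 + eps ^+ 2 * p)).
  by rewrite -abE ler_pM2l// (le_trans abD)// -[_ * theta * _]mulrA.
have DD : D ^+ 2 <= (a + b) ^+ 2 by rewrite ler_pXn2r ?nnegrE ?addr_ge0.
have pDe : 0 <= p * D * eps.
  exact: mulr_ge0 (mulr_ge0 (ltW p0) D0) (ltW e0).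
(* Since [D <= a + b], the terms [p * D ^+ 2] cancel in [abD], leaving
   [v ^+ 2 <= (p * D * eps) ^+ 2]. *)
have vle : v <= p * D * eps.
  have [v0|v0] := leP v 0; first exact: le_trans pDe.
  rewrite -(@ler_pXn2r _ 2) ?nnegrE ?(ltW v0)//.
  have : p * D ^+ 2 <= p * (a + b) ^+ 2 by rewrite ler_pM2l.
  by move: abD; lra.
have able : a + b <= D * (1 + eps).
  have De : 0 <= D * (1 + eps) by rewrite mulr_ge0 ?addr_ge0// ltW.
  rewrite -(@ler_pXn2r _ 2) ?nnegrE ?addr_ge0//.
  have : p * (a + b) ^+ 2 <= p * (D ^+ 2 * (1 + eps ^+ 2 * p)).
    by have := sqr_ge0 v; lra.
  rewrite ler_pM2l// => /le_trans; apply; rewrite exprMn ler_wpM2l ?sqr_ge0//.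
  have : eps ^+ 2 * p <= eps ^+ 2 by rewrite ler_piMr// sqr_ge0.
  by nra.
(* The first term is at most [theta * D * (1 + eps)], the second at most [theta * D * eps] because
   [p <= theta]. *)
have -> : a = theta * (a + b) + v by rewrite /v; ring.
have : theta * (a + b) <= theta * (D * (1 + eps)) by rewrite ler_pM2l.
have : p * D * eps <= theta * D * eps.
  apply: ler_wpM2r (ltW e0) _ _ _; apply: ler_wpM2r D0 _ _ _.
  by rewrite /p ler_piMr ?(ltW t0)//; lra.
by nra.
Qed.

Lemma approx_convex_fin (R : realType) (X : metricType R) (lambda : R)
    (phi : X -> \bar R) (o x : X) (po px theta eps : R) :
  approx_convex lambda phi -> phi o = po%:E -> phi x = px%:E ->
  0 < theta < 1 -> 0 < eps < 1 ->
  exists2 y, mdist o y <= theta * mdist o x * (1 + 2 * eps) &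
    (phi y <= ((1 - theta) * po + theta * px
      - (lambda - eps) / 2 * theta * (1 - theta) * mdist o x ^+ 2)%:E)%E.
Proof.
move=> cphi phio phix t01 e01.
have Do : Dom phi o by rewrite /Dom /= phio ltry.
have Dx : Dom phi x by rewrite /Dom /= phix ltry.
have [y [iy]] := cphi o x Do Dx theta eps t01 e01.
rewrite phio phix -!EFinM -EFinN -!EFinD => phiy; exists y => //.
by apply: intermediate_point_mdist => //; case/andP: e01.
Qed.

Lemma m_inf_le (R : realType) (X : metricType R) (phi : X -> \bar R)
    (o x : X) : mdist o x <= 1 -> (m_inf phi o <= phi x)%E.
Proof.
by move=> ox; apply: ereal_inf_lbound; exists x => //=; rewrite metric_sym.
Qed.

(* A very negative value on the unit ball would, by convexity along a fixed
   small fraction of the way from [o], produce values below [phi o - 1]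
   arbitrarily close to [o], against lower semicontinuity. *)
Lemma m_inf_gtNy (R : realType) (X : metricType R) (lambda : R)
    (phi : X -> \bar R) (o : X) (po : R) :
  (forall x, (-oo < phi x)%E) ->
  approx_convex lambda phi -> complete_sublevels phi -> phi o = po%:E ->
  (-oo < m_inf phi o)%E.
Proof.
move=> gtNy cphi complete phio.
have [|r r0 rP] := @complete_sublevels_lsc _ _ phi o (po - 1) complete.
  by rewrite phio lte_fin; lra.
(* With error 1/2 the intermediate point lies within [2 * t], hence within [r / 2], of [o]. [K]
   solves [po - 1 = (1 - t) * po + t * K + c], where [c], equal to |lambda| + 1, bounds the
   curvature term. *)
pose t := Num.min (2^-1) (r / 4).
have t0 : 0 < t by rewrite lt_min; apply/andP; split; lra.
have t2 : t <= 2^-1 by rewrite ge_min lexx.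
have tr : t <= r / 4 by rewrite ge_min lexx orbT.
pose K := ((po - 1 - (1 - t) * po) - (`|lambda| + 1)) / t.
apply: (@lt_le_trans _ _ K%:E); first exact: ltNyr.
apply: le_ereal_inf_tmp => _ [x /= xo <-]; move: (gtNy x).
case phix : (phi x) => [px| |] // _; last by rewrite leey.
have t01 : 0 < t < 1 by rewrite t0/=; lra.
have e01 : 0 < (2^-1 : R) < 1 by apply/andP; split; lra.
have [y oy phiy] :=
  approx_convex_fin _ _ _ _ _ _ _ _ _ _ cphi phio phix t01 e01.
have D0 := mdist_ge0 o x; rewrite metric_sym in xo.
have /rP /lt_le_trans/(_ phiy) : mdist o y < r.
  by apply: (le_lt_trans oy); nra.
rewrite !lte_fin lee_fin /K ler_pdivrMr// mulrC.
set D := mdist o x in xo D0 *.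
have D21 : D ^+ 2 <= 1 by rewrite expr_le1.
have tt : 0 <= t * (1 - t) * D ^+ 2 <= 1.
  have : 0 <= t * (1 - t) <= 1 by apply/andP; split; nra.
  move=> /andP[s0 s1]; have := sqr_ge0 D; nra.
have : - ((lambda - 2^-1) / 2 * t * (1 - t) * D ^+ 2) <= `|lambda| + 1.
  have -> : (lambda - 2^-1) / 2 * t * (1 - t) * D ^+ 2
    = (lambda - 2^-1) / 2 * (t * (1 - t) * D ^+ 2) by ring.
  have := ler_norm (- lambda); rewrite normrN.
  have := normr_ge0 lambda; move: tt => /andP[]; nra.
lra.
Qed.

(** Polynomials are continuous at 0; this is how the approximation error is sent to 0. *)
Lemma horner_right_ge (R : realType) (p : {poly R}) (m e0 : R) : 0 < e0 ->
  (forall e, 0 < e < e0 -> m <= p.[e]) -> m <= p.[0].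
Proof.
move=> e00 mp; have pp : p.[x] @[x --> 0^'+] --> p.[0].
  by apply: cvg_at_right_filter; exact: continuous_horner.
rewrite -(cvg_lim _ pp)//; apply: limr_ge; first by apply/cvg_ex; exists p.[0].
by near=> e; apply: mp; apply/andP; split; near: e;
  [exact: nbhs_right_gt|exact: nbhs_right_lt].
Unshelve. all: by end_near.
Qed.

(* Convexity at the point of the segment at distance about [1] from [o];
   taking the fraction [(1 - 2 e) / D] makes up for the error in the position
   of the intermediate point, which thus lies in the unit ball. *)
Lemma approx_convex_far (R : realType) (X : metricType R) (lambda : R)
    (phi : X -> \bar R) (o x : X) (po px m : R) :
  approx_convex lambda phi -> phi o = po%:E -> phi x = px%:E ->
  m_inf phi o = m%:E -> 1 <= mdist o x ->
  mdist o x * m <= (mdist o x - 1) * po + px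
    - lambda / 2 * (mdist o x ^+ 2 - mdist o x).
Proof.
move=> cphi phio phix mE; set D := mdist o x => D1.
have D0 : 0 < D by exact: lt_le_trans D1.
(* [p.[e]] is [D] times the right-hand side of approximate convexity with error [e] at the fraction
   [(1 - 2 * e) / D]; the factor [D] clears denominators and leaves a polynomial in [e]. *)
pose p : {poly R} := (D - 1)%:P * po%:P + 2%:P * po%:P * 'X + px%:P
  - 2%:P * px%:P * 'X
  - (lambda%:P - 'X) * 2^-1%:P * (1 - 2%:P * 'X) * ((D - 1)%:P + 2%:P * 'X)
    * D%:P.
have pE e : p.[e] = (D - 1 + 2 * e) * po + (1 - 2 * e) * px
    - (lambda - e) / 2 * (1 - 2 * e) * (D - 1 + 2 * e) * D.
  by rewrite /p !hornerE; ring.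
have -> : (D - 1) * po + px - lambda / 2 * (D ^+ 2 - D) = p.[0].
  by rewrite pE; ring.
apply: (@horner_right_ge _ _ _ 2^-1) => [|e /andP[e0 e2]]; first by lra.
rewrite pE.
pose t := (1 - 2 * e) / D.
have tD : t * D = 1 - 2 * e by rewrite /t divfK// gt_eqF.
have t01 : 0 < t < 1.
  by rewrite /t divr_gt0//= ?ltr_pdivrMr//; lra.
have e01 : 0 < e < 1 by rewrite e0/=; lra.
have [y oy phiy] :=
  approx_convex_fin _ _ _ _ _ _ _ _ _ _ cphi phio phix t01 e01.
(* The bound on the distance is [(1 - 2 * e) * (1 + 2 * e)], which is below 1. *)
have y1 : mdist o y <= 1 by apply: (le_trans oy); rewrite -/D tD; nra.
have := le_trans (m_inf_le _ _ phi o y y1) phiy.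
rewrite mE lee_fin -/D -(ler_pM2l D0) => /le_trans; apply.
have -> : 2 * e = 1 - t * D by rewrite tD; ring.
rewrite le_eqVlt; apply/orP; left; apply/eqP; ring.
Qed.

Lemma Dom_fin_num (R : realType) (X : metricType R) (phi : X -> \bar R)
    (o : X) : (-oo < phi o)%E -> Dom phi o -> exists po, phi o = po%:E.
Proof. by rewrite /Dom /=; case: (phi o) => // po _ _; exists po. Qed.

(** Gathers what both final bounds use about [x], which reduces them to real arithmetic. The far
    alternative is [approx_convex_far] solved for [po]. *)
Lemma approx_convex_bounds (R : realType) (X : metricType R) (lambda : R)
    (phi : X -> \bar R) (o x : X) (po px m : R) :
  approx_convex lambda phi -> phi o = po%:E -> phi x = px%:E ->
  m_inf phi o = m%:E ->
  (mdist x o <= 1 /\ m <= px) \/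
  (1 <= mdist x o /\
   po <= px - lambda / 2 * mdist x o ^+ 2
     + (po - m + lambda / 2) * mdist x o).
Proof.
move=> cphi phio phix mE; rewrite metric_sym; have [D1|D1] := leP (mdist o x) 1.
  by left; split=> //; rewrite -lee_fin -mE -phix m_inf_le.
right; split; first exact: ltW.
have := approx_convex_far _ _ _ _ _ _ _ _ _ cphi phio phix mE (ltW D1); lra.
Qed.

(** [A] stands for [po - m]. The constant comes from Young's inequality [P * u <= P ^+ 2 / (2 * s) +
    s / 2 * u ^+ 2], taken at [u = 1] when [D <= 1] and at [u = D] otherwise. *)
Lemma phi_cst_le (R : realType) (A lambda kappa po px D : R) : 0 <= D ->
  0 <= A -> - lambda < kappa ->
  (D <= 1 /\ po - A <= px) \/
    (1 <= D /\ po <= px - lambda / 2 * D ^+ 2 + (A + lambda / 2) * D) ->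
  po - (A + Num.max lambda 0 / 2) ^+ 2 / (2 * (lambda + kappa))
    - (lambda + kappa) / 2 <= px + kappa / 2 * D ^+ 2.
Proof.
move=> D0 A0 lk.
have l0 : 0 <= Num.max lambda 0 by rewrite le_max lexx orbT.
have ll : lambda <= Num.max lambda 0 by rewrite le_max lexx.
pose s := lambda + kappa; pose P := A + Num.max lambda 0 / 2.
have s0 : 0 < s by rewrite /s; lra.
rewrite -/s -/P.
have young (u : R) : 0 <= P ^+ 2 / (2 * s) - P * u + s / 2 * u ^+ 2.
  have -> : P ^+ 2 / (2 * s) - P * u + s / 2 * u ^+ 2
      = (P - s * u) ^+ 2 / (2 * s).
    by field; rewrite gt_eqF.
  by rewrite divr_ge0 ?sqr_ge0// mulr_ge0// ltW.
have -> : kappa = s - lambda by rewrite /s; ring.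
case=> [] [D1 pxD].
- have D21 : D ^+ 2 <= 1 by rewrite expr_le1.
  have := young 1; have : lambda * D ^+ 2 <= Num.max lambda 0.
    by have := sqr_ge0 D; nra.
  have : 0 <= s * D ^+ 2 by rewrite mulr_ge0 ?sqr_ge0// ltW.
  rewrite /P; lra.
- have := young D.
  have : lambda * D <= Num.max lambda 0 * D by rewrite ler_wpM2r.
  rewrite /P; lra.
Qed.

(** For [D >= 1] the right-hand side is at least [po], hence at least [m]. For [D <= 1] the factor
    [D - D ^+ 2] of [lambda / 2] lies between 0 and 1, so only a negative [lambda] costs
    anything. *)
Lemma phi'_cst_le (R : realType) (lambda po px m D : R) : 0 <= D ->
  m <= po ->
  (D <= 1 /\ m <= px) \/
    (1 <= D /\ po <= px - lambda / 2 * D ^+ 2 + (po - m + lambda / 2) * D) ->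
  m - Num.max (- lambda) 0 / 2
    <= px - lambda / 2 * D ^+ 2 + (po - m + lambda / 2) * D.
Proof.
move=> D0 mpo.
have l0 : 0 <= Num.max (- lambda) 0 by rewrite le_max lexx orbT.
have ll : - lambda <= Num.max (- lambda) 0 by rewrite le_max lexx.
case=> [] [D1 pxD]; last by lra.
have DD : 0 <= D - D ^+ 2 <= 1 by apply/andP; split; nra.
have : 0 <= (po - m) * D by rewrite mulr_ge0// subr_ge0.
have : - Num.max (- lambda) 0 <= lambda * (D - D ^+ 2).
  by move: DD => /andP[]; nra.
lra.
Qed.

Theorem theorem2p17 (R : realType) (X : metricType R) (lambda : R)
    (phi : X -> \bar R)
    (X_nonempty : [set: X] !=set0)
    (phi_gtNy : forall x, (-oo < phi x)%E)
    (phi_convex : approx_convex lambda phi)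
    (phi_complete : complete_sublevels phi) :
  quadratically_bounded_below phi /\
  forall o : X, Dom phi o ->
    [/\ (-oo < m_inf phi o)%E,
        forall kappa : R, - lambda < kappa -> forall x : X,
          ((phi_cst lambda kappa phi o)%:E
             <= phi x + (kappa / 2 * mdist x o ^+ 2)%:E)%E,
        linearly_bounded_below (sub_quadratic lambda phi o) &
        forall x : X,
          ((phi'_cst lambda phi o)%:E
             <= sub_quadratic lambda phi o x
                + (ell_cst lambda phi o * mdist x o)%:E)%E].
Proof.
suff main (o : X) : Dom phi o ->
    [/\ (-oo < m_inf phi o)%E,
        forall kappa : R, - lambda < kappa -> forall x : X,
          ((phi_cst lambda kappa phi o)%:E
             <= phi x + (kappa / 2 * mdist x o ^+ 2)%:E)%E &
        forall x : X,
          ((phi'_cst lambda phi o)%:E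
             <= sub_quadratic lambda phi o x
                + (ell_cst lambda phi o * mdist x o)%:E)%E].
  split; last first.
    move=> o oD; have [mo qo lo] := main o oD; split=> //.
    by exists o, (phi'_cst lambda phi o), (ell_cst lambda phi o).
  have [[z zD]|noD] := pselect (exists o, Dom phi o).
    (* The choice [1 - lambda] exceeds [- lambda] and makes [lambda + kappa] equal to 1. *)
    have [_ qo _] := main z zD.
    by exists z, (phi_cst lambda (1 - lambda) phi z), (1 - lambda);
      apply: qo; lra.
  (* With an empty domain [phi] is [+oo] everywhere, so any base point and constants work. *)
  have [z _] := X_nonempty; exists z, 0, 0 => x.
  suff -> : phi x = +oo%E by rewrite addye ?leey.
  by apply/eqP; rewrite -leye_eq leNgt; apply/negP => xD; apply: noD; exists x.
move=> oD; have [po phio] := Dom_fin_num _ _ _ _ (phi_gtNy o) oD.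
have mNy := m_inf_gtNy _ _ _ _ _ _ phi_gtNy phi_convex phi_complete phio.
have mo : (m_inf phi o <= po%:E)%E by rewrite -phio m_inf_le ?mdistxx.
have [m mE] : exists m, m_inf phi o = m%:E.
  by move: mNy mo; case: (m_inf phi o) => // m _ _; exists m.
move: mo; rewrite mE lee_fin => mpo.
split=> [|kappa lk x|x]; first by rewrite -mE.
- rewrite /phi_cst mE phio /=.
  case phix : (phi x) (phi_gtNy x) => [px| |] // _; last by rewrite addye ?leey.
  rewrite -EFinD lee_fin; apply: phi_cst_le => //.
  + exact: mdist_ge0.
  + by rewrite subr_ge0.
  + by rewrite subKr; exact: approx_convex_bounds phi_convex phio phix mE.
- rewrite /phi'_cst /ell_cst /sub_quadratic mE phio /=.
  case phix : (phi x) (phi_gtNy x) => [px| |] // _;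
    last by rewrite !addye ?leey.
  rewrite -EFinB -EFinD lee_fin; apply: phi'_cst_le => //.
  + exact: mdist_ge0.
  + exact: approx_convex_bounds phi_convex phio phix mE.
Qed.
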